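(* Let $f:\mathbb{R}^p\to\mathbb{R}$ be $L_f$-smooth and let $g:\mathbb{R}^p\to\mathbb{R}\cup\{\infty\}$ be proper, convex and lower semicontinuous. For $\gamma\in(0,1/L_f)$ let $E_\gamma:=g^\gamma-(-f)^\gamma$ be the DC envelope of $g-(-f)$, and let $$\varphi_\gamma^{\mathrm{FB}}(u):=f(u)-\tfrac\gamma2\|\nabla f(u)\|^2+g^\gamma\bigl(u-\gamma\nabla f(u)\bigr)$$ be the forward-backward envelope. Then, for every $\gamma\in(0,1/L_f)$, $$\varphi_\gamma^{\mathrm{FB}}=E_\gamma\circ(\mathrm{id}-\gamma\nabla f)\quad\text{and}\quad E_\gamma=\varphi_\gamma^{\mathrm{FB}}\circ\operatorname{prox}_{-\gamma f}.$$ Moreover, $E_\gamma$ is $\frac{1}{\gamma(1-\gamma L_f)}$-smooth, and if $f$ is additionally convex then so is $E_\gamma$.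
   Context: A function is $L$-smooth if it is differentiable with $L$-Lipschitz continuous gradient. For a function $\phi:\mathbb{R}^p\to\mathbb{R}\cup\{\infty\}$ and $\gamma>0$, $\operatorname{prox}_{\gamma \phi}(x)=\operatorname{argmin}_{w}\{\phi(w)+\tfrac1{2\gamma}\|w-x\|^2\}$ and $\phi^\gamma(x)=\inf_{w}\{\phi(w)+\tfrac1{2\gamma}\|w-x\|^2\}$ (Moreau envelope); $\operatorname{prox}_{-\gamma f}$ means $\operatorname{prox}_{\gamma\phi}$ with $\phi=-f$, which is single-valued since $\gamma<1/L_f$. Convention: $1/0=\infty$. *)

(* Defs.v *)
(* MathComp-Analysis, over an arbitrary R : realType.
   Points of R^p are row vectors 'rV[R]_p.  The library's norm on 'rV[R]_p is
   the sup norm; it is only used through the topology it induces (for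
   [differentiable] and [lower_semicontinuous]).  Every metric quantity below
   uses the Euclidean norm [enorm]. *)
From HB Require Import structures.
From mathcomp Require Import all_boot all_order all_algebra.
From mathcomp Require Import all_classical all_reals all_analysis.

Set Implicit Arguments.
Unset Strict Implicit.
Unset Printing Implicit Defensive.

Import Order.TTheory GRing.Theory Num.Theory.
Import numFieldNormedType.Exports.

Local Open Scope classical_set_scope.
Local Open Scope ring_scope.

Section Definitions.
Context {R : realType} {p : nat}.
Implicit Types (f : 'rV[R]_p -> R) (phi g h : 'rV[R]_p -> \bar R).
Implicit Types (gamma L : R) (x u w : 'rV[R]_p).

Definition enorm x : R := Num.sqrt (\sum_(i < p) x 0 i ^+ 2).

(* Row vector of partial derivatives; meaningful where f is differentiable. *)
Definition grad f x : 'rV[R]_p := \row_(i < p) 'D_(delta_mx 0 i) f x.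

Definition L_smooth L f : Prop :=
  (forall x, differentiable f x) /\
  (forall x y, enorm (grad f x - grad f y) <= L * enorm (x - y)).

(* phi takes values in R \cup {oo} and is not identically oo. *)
Definition proper_efun phi : Prop :=
  (forall x, phi x != -oo%E) /\ (exists x, (phi x < +oo)%E).

(* For phi > -oo the right-hand side never meets oo - oo, and 0 * oo = 0 makes
   the cases t = 0 and t = 1 trivial. *)
Definition econvex phi : Prop :=
  forall x y (t : R), 0 <= t <= 1 ->
    (phi (t *: x + (1 - t) *: y)%R <= t%:E * phi x + (1 - t)%:E * phi y)%E.

Definition prox_objective gamma phi x w : \bar R :=
  (phi w + ((2 * gamma)^-1 * enorm (w - x) ^+ 2)%:E)%E.

Definition prox_set gamma phi x : set 'rV[R]_p :=
  [set w | forall v, (prox_objective gamma phi x w <=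
                      prox_objective gamma phi x v)%E].

(* A selection of [prox_set]: the proximal point when [prox_set gamma phi x]
   is a singleton, and the junk value 0 when it is empty. *)
Definition prox gamma phi x : 'rV[R]_p := xget 0 (prox_set gamma phi x).

Definition moreau gamma phi x : \bar R :=
  ereal_inf (range (prox_objective gamma phi x)).

Definition dc_envelope gamma g h x : \bar R :=
  (moreau gamma g x - moreau gamma h x)%E.

Definition eopp f x : \bar R := (- f x)%:E.

Definition fb_envelope gamma f g u : \bar R :=
  ((f u - gamma / 2 * enorm (grad f u) ^+ 2)%:E +
   moreau gamma g (u - gamma *: grad f u)%R)%E.

End Definitions.

(* Main.v *)
Require Import Defs.
From HB Require Import structures.
From mathcomp Require Import all_boot all_order all_algebra ring lra.
From mathcomp Require Import all_classical all_reals all_analysis.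

Set Implicit Arguments.
Unset Strict Implicit.
Unset Printing Implicit Defensive.

Import Order.TTheory GRing.Theory Num.Theory.
Import numFieldNormedType.Exports.

Local Open Scope classical_set_scope.
Local Open Scope ring_scope.

(** Write P for the proximal map of -f and Q for that of g, both with parameter
gamma.

By the descent inequality ([descent]), L/2 |.|^2 - f is convex, so for
gamma * L < 1 the objective w |-> -f(w) + |w - x|^2 / (2 gamma) is strongly convex.
Its growth around a critical point u, that is, a solution of
u - gamma * grad f(u) = x, is [forward_step_prox]; it makes u the only minimizer.
Conversely a minimizer exists by coercivity and solves this equation
([prox_eopp_fermat]).  Hence P is the inverse of id - gamma * grad f, and the
envelope of -f at u - gamma * grad f(u) is -f(u) + gamma/2 |grad f(u)|^2; this is
the identity between the two envelopes, read at u or at u = P(x).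

For smoothness, a Moreau envelope M with a Lipschitz selection S of its
proximal map lies below the quadratic
M(x) + <x - S(x), y - x> / gamma + |y - x|^2 / (2 gamma), and exchanging x and y
turns this into a two-sided quadratic expansion ([quadratic_remainder]), so that
M is differentiable with gradient (x - S(x)) / gamma.  The gradient of the DC
envelope is therefore (P - Q) / gamma.  Now P is (1 - gamma L)-cocoercive and Q
is firmly nonexpansive; morally P and Q have symmetric Jacobians with
0 <= P' <= a := 1 / (1 - gamma L) and 0 <= Q' <= 1, so -1 <= P' - Q' <= a, and the
Lipschitz constant of P - Q is a rather than a + 1.  [cocoercive_sub] is this
bound without derivatives.

For convexity, the envelope of g is convex as a partial minimization of a
jointly convex function, and minus the envelope of -f is
x |-> sup_d (f(x + d) - |d|^2 / (2 gamma)), a supremum of convex functions when f is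
convex. *)

(** * Euclidean inner product on row vectors *)

Section EuclideanGeometry.
Context {R : realType} {p : nat}.
Implicit Types (x y z : 'rV[R]_p) (c K : R).

Definition dot x y : R := \sum_(i < p) x 0 i * y 0 i.

Lemma dotC x y : dot x y = dot y x.
Proof. by apply: eq_bigr => i _; rewrite mulrC. Qed.

Lemma dotDl x y z : dot (x + y) z = dot x z + dot y z.
Proof. by rewrite -big_split; apply: eq_bigr => i _; rewrite mxE mulrDl. Qed.

Lemma dotZl c x y : dot (c *: x) y = c * dot x y.
Proof. by rewrite mulr_sumr; apply: eq_bigr => i _; rewrite mxE mulrA. Qed.

Lemma dotNl x y : dot (- x) y = - dot x y.
Proof. by rewrite -scaleN1r dotZl mulN1r. Qed.

Lemma dotDr x y z : dot z (x + y) = dot z x + dot z y.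
Proof. by rewrite dotC dotDl !(dotC z). Qed.

Lemma dotZr c x y : dot x (c *: y) = c * dot x y.
Proof. by rewrite dotC dotZl dotC. Qed.

Lemma dotNr x y : dot x (- y) = - dot x y.
Proof. by rewrite dotC dotNl dotC. Qed.

Definition dotE := (dotDl, dotDr, dotNl, dotNr, dotZl, dotZr).

Lemma dot_ge0 x : 0 <= dot x x.
Proof. by apply: sumr_ge0 => i _; rewrite -expr2 sqr_ge0. Qed.

Lemma dot_eq0 x : dot x x = 0 -> x = 0.
Proof.
move=> /eqP; rewrite psumr_eq0 => [/allP x0|i _]; last by rewrite -expr2 sqr_ge0.
apply/rowP => i; rewrite mxE.
by have := x0 i (mem_index_enum _); rewrite mulf_eq0 orbb => /eqP.
Qed.

Lemma enorm_sqr x : enorm x ^+ 2 = dot x x.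
Proof.
have -> : dot x x = \sum_(i < p) x 0 i ^+ 2 by apply: eq_bigr => i _; rewrite expr2.
by rewrite sqr_sqrtr // sumr_ge0 // => i _; rewrite sqr_ge0.
Qed.

Lemma enorm_leP c x y : 0 <= c ->
  (enorm x <= c * enorm y) = (dot x x <= c ^+ 2 * dot y y).
Proof.
move=> c0; rewrite -!enorm_sqr -exprMn ler_pXn2r // nnegrE ?mulr_ge0 //;
  exact: sqrtr_ge0.
Qed.

(** Expand the square of [<y, y> x - <x, y> y], whose norm is never negative. *)
Lemma cauchy_schwarz x y : dot x y ^+ 2 <= dot x x * dot y y.
Proof.
have [y0|y0] := eqVneq (dot y y) 0.
  rewrite y0 (dot_eq0 y0) mulr0.
  by rewrite -(scale0r (0 : 'rV[R]_p)) dotZr mul0r expr0n.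
have yy0 : 0 < dot y y by rewrite lt_def y0 dot_ge0.
have := dot_ge0 (dot y y *: x - dot x y *: y).
rewrite !dotE (dotC y x) => h.
rewrite -subr_ge0 -(pmulr_rge0 _ yy0); apply: le_trans h _.
rewrite le_eqVlt; apply/orP; left; apply/eqP; ring.
Qed.

(** Cauchy-Schwarz in the shape in which Lipschitz bounds are used below. *)
Lemma dot_le_of_norm K x y : 0 <= K ->
  dot x x <= K ^+ 2 * dot y y -> `|dot x y| <= K * dot y y.
Proof.
move=> K0 xy; rewrite -ler_sqr ?nnegrE ?mulr_ge0 ?dot_ge0 //.
rewrite -normrX ger0_norm ?sqr_ge0 //.
apply: le_trans (cauchy_schwarz x y) _.
by rewrite exprMn expr2 [dot y y ^+ 2]expr2 mulrA ler_wpM2r ?dot_ge0.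
Qed.

(** With [x = K (z + x') / 2] and [y = (z + y') / 2] the hypotheses say that [x']
and [y'] have norm at most that of [z].  Then
[x - y = (K - 1)/2 z + K/2 x' - 1/2 y'] has weights of total mass [K], which bounds
its norm by [K |z|].  The identity in the proof is the corresponding sum of
squares. *)
Lemma cocoercive_sub K x y z : 1 <= K ->
  dot x x <= K * dot x z -> dot y y <= dot y z ->
  dot (x - y) (x - y) <= K ^+ 2 * dot z z.
Proof.
move=> K1 xz yz.
rewrite -subr_ge0 -(pmulr_rge0 _ (lt_le_trans ltr01 K1)).
have K0 : 0 <= K by apply: le_trans K1.
have K10 : 0 <= K - 1 by rewrite subr_ge0.
have -> : K * (K ^+ 2 * dot z z - dot (x - y) (x - y)) =
  2 * K * (K * dot x z - dot x x) + 2 * K ^+ 2 * (dot y z - dot y y) +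
  (K - 1) * dot (K *: z - x) (K *: z - x) + K * (K - 1) * dot y y +
  dot (x + K *: (y - z)) (x + K *: (y - z)).
  by rewrite !dotE (dotC y x) (dotC z x) (dotC z y); ring.
by rewrite !addr_ge0 ?dot_ge0 ?mulr_ge0 ?dot_ge0 ?subr_ge0 ?sqr_ge0.
Qed.

Lemma cocoercive_lipschitz K x z : 1 <= K ->
  dot x x <= K * dot x z -> dot x x <= K ^+ 2 * dot z z.
Proof.
move=> K1 /(cocoercive_sub (y := 0) K1); rewrite subr0; apply.
by rewrite -(scale0r (0 : 'rV[R]_p)) !dotZl !mul0r.
Qed.

End EuclideanGeometry.

(** * Quadratic bounds for smooth functions *)

Section Smoothness.
Context {R : realType} {p : nat}.
Implicit Types (f : 'rV[R]_p -> R) (x d v : 'rV[R]_p) (L C : R).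

Lemma derive_grad f x v : differentiable f x -> 'D_v f x = dot (grad f x) v.
Proof.
move=> df; rewrite deriveE // {1}(row_sum_delta v) linear_sum /=.
apply: eq_bigr => i _; rewrite linearZ /= mxE deriveE //.
by rewrite mulrC.
Qed.

Lemma is_derive_line f x d t : differentiable f (x + t *: d) ->
  is_derive (t : R^o) (1 : R^o) (fun s : R^o => f (x + s *: d))
    (dot (grad f (x + t *: d)) d).
Proof.
move=> df; rewrite -derive_grad //.
have E : (fun h : R =>
    h^-1 *: (((fun s : R^o => f (x + s *: d)) \o shift t) (h *: 1) -
    f (x + t *: d))) =
  (fun h : R => h^-1 *: ((f \o shift (x + t *: d)) (h *: d) - f (x + t *: d))).
  apply/funext => h /=; congr (_ *: (f _ - _)).
  by rewrite [h *: 1]mulr1 scalerDl addrCA addrA.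
have df' := @diff_derivable _ _ _ f _ d df.
split; first by rewrite /derivable E; exact: df'.
by rewrite /derive E.
Qed.

(** The function [psi] of the proof interpolates between [x] and [x + d]; the term
[L / 2 * s ^ 2] makes its derivative nonpositive, whereas the mean value theorem
without it would lose a factor 2.  The sign [e] treats both inequalities at once. *)
Lemma descent f L x d : 0 <= L -> L_smooth L f ->
  `|f (x + d) - f x - dot (grad f x) d| <= L / 2 * dot d d.
Proof.
move=> L0 [df Lf].
suff H (e : R) : `|e| = 1 ->
    e * (f (x + d) - f x - dot (grad f x) d) <= L / 2 * dot d d.
  have := H 1; have := H (- 1).
  by rewrite normrN normr1 mul1r mulN1r ler_norml lerNl => -> // ->.
move=> e1.
pose psi (s : R^o) : R^o :=
  e * (f (x + s *: d) - dot (grad f x) d * s) - L / 2 * dot d d * s ^+ 2.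
pose dpsi (s : R) :=
  e * (dot (grad f (x + s *: d)) d - dot (grad f x) d) - L * s * dot d d.
have psiD s : is_derive (s : R^o) (1 : R^o) psi (dpsi s).
  have fD := is_derive_line (df (x + s *: d)).
  apply: is_derive_eq.
  by rewrite /dpsi /GRing.scale /=; field.
have psic : {within `[0, 1], continuous psi}.
  by apply: derivable_within_continuous => s _; have [] := psiD s.
have [c] := MVT_segment ler01 (fun s _ => psiD s) psic.
rewrite in_itv /= => /andP[c0 c1].
rewrite subr0 mulr1 /psi scale1r scale0r addr0 => psiE.
suff : dpsi c <= 0 by rewrite -psiE; lra.
rewrite /dpsi subr_le0 -dotNl -dotDl.
apply: le_trans (ler_norm _) _; rewrite normrM e1 mul1r.
apply: dot_le_of_norm; first exact: mulr_ge0.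
have := Lf (x + c *: d) x; rewrite enorm_leP // [x + _]addrC addrK !dotE.
by rewrite exprMn [c ^+ 2]expr2 -!mulrA.
Qed.

End Smoothness.

Section QuadraticExpansion.
Context {R : realType} {p : nat}.
Implicit Types (F : 'rV[R]_p -> R) (x d v G : 'rV[R]_p) (C : R).

Lemma coord_le_norm d i : `|d 0 i| <= `|d|.
Proof.
rewrite [leRHS]/Num.norm /= mx_normrE.
by apply/bigmax_geP; right; exists (0, i).
Qed.

Lemma dot_le_norm d : dot d d <= p%:R * `|d| ^+ 2.
Proof.
rewrite -[p in p%:R]card_ord mulr_natl -sumr_const; apply: ler_sum => i _.
by rewrite -expr2 -real_normK ?num_real // ler_sqr ?nnegrE // coord_le_norm.
Qed.

Lemma norm_le_enorm d : `|d| <= enorm d.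
Proof.
rewrite [leLHS]/Num.norm /= mx_normrE; apply/bigmax_leP; split=> [|[i j] _ /=].
  exact: sqrtr_ge0.
rewrite -[leLHS]ger0_norm // -sqrtr_sqr ler_wsqrtr // ord1.
rewrite real_normK ?num_real // (bigD1 j) //= lerDl sumr_ge0 // => k _.
exact: sqr_ge0.
Qed.

Lemma dot_continuous (T : topologicalType) (u v : T -> 'rV[R]_p) :
  continuous u -> continuous v -> continuous (fun t => dot (u t) (v t) : R^o).
Proof.
move=> uc vc.
have -> : (fun t => dot (u t) (v t) : R^o) =
    \sum_(i < p) (fun t => u t 0 i * v t 0 i : R^o).
  by apply/funext => t; rewrite fct_sumE.
elim/big_ind : _ => [|a b ac bc|i _].
- exact: cst_continuous.
- by move=> t; apply: continuousD; [exact: ac|exact: bc].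
- move=> t; apply: (@continuousM _ _ (fun t => u t 0 i) (fun t => v t 0 i)).
    apply: (@continuous_comp _ _ _ u (fun w : 'rV[R]_p => w 0 i)) ; first exact: uc.
    exact: (@coord_continuous R 1 p 0 i (u t)).
  apply: (@continuous_comp _ _ _ v (fun w : 'rV[R]_p => w 0 i)) ; first exact: vc.
  exact: (@coord_continuous R 1 p 0 i (v t)).
Qed.

(** A second-order remainder is negligible, in whichever norm, so [G] represents
the differential; its coordinates are the partial derivatives. *)
Lemma grad_quadratic_bound F x G C :
  (forall d, `|F (x + d) - F x - dot G d| <= C * dot d d) ->
  differentiable F x /\ grad F x = G.
Proof.
move=> FG.
have dotG_linear : linear (fun v => dot G v : R).
  by move=> c u v; rewrite !dotE.
pose dG : {linear 'rV[R]_p -> R} := HB.pack (fun v => dot G v : R)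
  (GRing.isLinear.Build R 'rV[R]_p R *%R (fun v => dot G v : R) dotG_linear).
have dGc : continuous dG.
  apply: (@dot_continuous _ (fun=> G) id); first exact: cst_continuous.
  by move=> ?; exact: cvg_id.
have FE : F \o shift x = cst (F x) + dG +o_ (0 : 'rV[R]_p) id.
  apply/eqaddoP => eps eps0.
  pose K := `|C| * p%:R + 1.
  have K0 : 0 < K by rewrite ltr_wpDl // mulr_ge0.
  have near0 : \forall d \near (0 : 'rV[R]_p), `|d| <= eps / K.
    by apply: nbhs0_le; rewrite divr_gt0.
  near=> d.
  rewrite /= -[(_ - _) d]/(F (d + x) - (F x + dot G d)) opprD addrA (addrC d).
  apply: le_trans (FG d) _.
  have dK : `|d| <= eps / K.
    by near: d; exact: near0.
  have : C * dot d d <= K * `|d| ^+ 2.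
    apply: (@le_trans _ _ (`|C| * (p%:R * `|d| ^+ 2))).
      apply: le_trans (ler_wpM2r (dot_ge0 _) (ler_norm C)) _.
      by rewrite ler_wpM2l // dot_le_norm.
    by rewrite mulrA ler_wpM2r // ?sqr_ge0 // /K lerDl.
  move=> h; apply: le_trans h _.
  by rewrite expr2 mulrA ler_wpM2r // mulrC -ler_pdivlMr.
have dE : 'd F x = dG :> ('rV[R]_p -> R) by exact: diff_unique.
have Fx : differentiable F x.
  by apply/diff_locallyP; rewrite dE.
split=> //; apply/rowP => i; rewrite mxE deriveE // dE /= /dot (bigD1 i) //=.
rewrite big1 => [|j ji]; first by rewrite mxE !eqxx mulr1 addr0.
by rewrite mxE (negbTE ji) andbF mulr0.
Unshelve. all: by end_near.
Qed.

End QuadraticExpansion.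

(** * Minimizers of lower semicontinuous functions *)

Section LowerSemicontinuity.
Context {R : realType}.

Lemma ereal_dense (x y : \bar R) : (x < y)%E ->
  exists2 a : R, (x < a%:E)%E & (a%:E < y)%E.
Proof.
case: x y => [x| |] [y| |] //=; rewrite ?ltxx // ?lte_fin => xy.
- by exists ((x + y) / 2); rewrite lte_fin; lra.
- by exists (x + 1); rewrite ?ltry // lte_fin; lra.
- by exists (y - 1); rewrite ?ltNyr // lte_fin; lra.
- by exists 0; rewrite ?ltry ?ltNyr.
Qed.

(** Let [m] be the infimum on [K].  If it is not attained, each point of [K] has a
neighbourhood on which [phi] exceeds some real [a > m]; by compactness a single
[a] works on the whole of [K], against the choice of [m]. *)
Lemma lsc_compact_min (T : topologicalType) (phi : T -> \bar R) (K : set T) :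
  lower_semicontinuous phi -> compact K -> K !=set0 ->
  exists2 x, K x & forall y, K y -> (phi x <= phi y)%E.
Proof.
move=> lphi cK [x0 Kx0]; pose m := ereal_inf (phi @` K).
have mE y : K y -> (m <= phi y)%E.
  by move=> Ky; apply: ereal_inf_lbound; exists y.
apply: contrapT => nomin.
have gt_m y : K y -> exists2 a : R, (m < a%:E)%E & (a%:E < phi y)%E.
  move=> Ky; have : (m < phi y)%E.
    rewrite ltNge; apply/negP => phiy; apply: nomin; exists y => // z Kz.
    by apply: le_trans phiy _; exact: mE.
  by exact: ereal_dense.
(* The filter of the reals that decrease to [m]; [m] may be [-oo]. *)
pose F := filter_from [set a : R | (m < a%:E)%E] (fun a => [set b | b <= a]).
have FF : Filter F.
  apply: filter_from_filter => [|a b ma mb].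
    by have [a] := gt_m _ Kx0; exists a.
  exists (Num.min a b) => [|c /=]; first by rewrite /= /Num.min; case: ifP.
  by rewrite le_min => /andP.
have /compact_near_coveringP := cK.
move=> /(_ _ F (fun a y => (a%:E <= phi y)%E) FF)[].
  move=> y Ky; have [a ma /lphi[V Vy aV]] := gt_m _ Ky.
  exists (V, [set b | b <= a]) => [|[z b] [/= Vz ba]].
    by split=> //; exists a.
  by rewrite (le_trans _ (ltW (aV z Vz))) // lee_fin.
move=> a /= ma Ka; have : (a%:E <= m)%E.
  by apply/ereal_infP => _ [y Ky <-]; apply: Ka => /=.
by rewrite leNgt ma.
Qed.

Lemma lsc_addr (T : topologicalType) (phi : T -> \bar R) (q : T -> R^o) :
  lower_semicontinuous phi -> continuous q ->
  lower_semicontinuous (fun t => phi t + (q t)%:E)%E.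
Proof.
move=> lphi qc x a; rewrite -lteBlDr // -EFinB => /ereal_dense[b].
rewrite lte_fin => ab /lphi[V Vx bV].
exists (V `&` [set y | a - b < q y]).
  apply: filterI => //.
  apply: (qc x [set s | a - b < s]); apply: open_nbhs_nbhs; split.
    exact: open_gt.
  by rewrite /=; lra.
move=> y [/bV bphi aq].
rewrite -lteBlDr // -EFinB (lt_trans _ bphi) // lte_fin /=.
by move: aq => /=; lra.
Qed.

Lemma lsc_coercive_min (p : nat) (phi : 'rV[R]_p -> \bar R) M w0 :
  lower_semicontinuous phi ->
  (forall w, M < `|w| -> (phi w0 <= phi w)%E) ->
  exists w, forall v, (phi w <= phi v)%E.
Proof.
move=> lphi phiM; pose r := Num.max M `|w0|.
pose K := [set w : 'rV[R]_p | `|w| <= r].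
have cK : compact K.
  apply: bounded_closed_compact.
    exists r; split=> [|s rs w /= wr]; first exact: num_real.
    exact: le_trans wr (ltW rs).
  apply: (@closed_comp _ _ (fun w : 'rV[R]_p => `|w| : R^o) [set s | s <= r]).
    by move=> w _; exact: norm_continuous.
  exact: closed_le.
have Kw0 : K w0 by rewrite /K /= le_max lexx orbT.
have [w Kw wmin] := lsc_compact_min lphi cK (ex_intro _ _ Kw0).
exists w => v; have [Kv|rv] := leP `|v| r; first exact: wmin.
apply: le_trans (wmin _ Kw0) (phiM _ _).
by move: rv; rewrite gt_max => /andP[].
Qed.

End LowerSemicontinuity.

(** * Proximal points and Moreau envelopes *)

Section ProximalPoints.
Context {R : realType} {p : nat}.
Implicit Types (phi g : 'rV[R]_p -> \bar R) (x y u w : 'rV[R]_p) (gamma : R).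

Lemma prox_objectiveE gamma phi x w :
  prox_objective gamma phi x w =
    (phi w + (gamma^-1 / 2 * dot (w - x) (w - x))%:E)%E.
Proof. by rewrite /prox_objective enorm_sqr invfM [_ * gamma^-1]mulrC. Qed.

Lemma prox_set_prox gamma phi x : prox_set gamma phi x !=set0 ->
  prox_set gamma phi x (prox gamma phi x).
Proof. exact: xgetPex. Qed.

Lemma moreau_le gamma phi x w :
  (moreau gamma phi x <= prox_objective gamma phi x w)%E.
Proof. by apply: ereal_inf_lbound; exists w. Qed.

Lemma moreau_prox_set gamma phi x w : prox_set gamma phi x w ->
  moreau gamma phi x = prox_objective gamma phi x w.
Proof.
move=> wmin; apply/eqP; rewrite eq_le moreau_le /=.
by apply/ereal_infP => _ [v _ <-].
Qed.

(** A lower bound on [phi] of curvature [- L] is dominated by the quadratic term of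
the objective, of curvature [1 / gamma > L], so the objective is coercive. *)
Lemma prox_set_nonempty gamma phi x w0 (L B C : R) :
  0 < gamma -> gamma * L < 1 -> lower_semicontinuous phi -> (phi w0 < +oo)%E ->
  (forall w,
    ((- (C + B * enorm (w - x) + L / 2 * enorm (w - x) ^+ 2))%:E <= phi w)%E) ->
  prox_set gamma phi x !=set0.
Proof.
move=> gamma0 gammaL lphi phiw0 phi_ge.
have phi_fin : phi w0 \is a fin_num.
  by rewrite fin_real // phiw0 andbT (lt_le_trans (ltNyr _) (phi_ge w0)).
pose r := fine (phi w0) + gamma^-1 / 2 * dot (w0 - x) (w0 - x).
have objw0 : prox_objective gamma phi x w0 = r%:E.
  by rewrite prox_objectiveE EFinD fineK.
pose c := (gamma^-1 - L) / 2.
have c0 : 0 < c by rewrite divr_gt0 // subr_gt0 -div1r ltr_pdivlMr // mulrC.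
(* Beyond distance [n0 >= 1] from [x], the term [c * n ^ 2] absorbs the linear and
   the constant ones. *)
pose n0 := 1 + (`|B| + `|C| + `|r|) / c.
have lobj : lower_semicontinuous (prox_objective gamma phi x).
  have -> : prox_objective gamma phi x =
      (fun w => phi w + (gamma^-1 / 2 * dot (w - x) (w - x))%:E)%E.
    by apply/funext => w; exact: prox_objectiveE.
  have sub_continuous : continuous (fun w : 'rV[R]_p => w - x).
    by move=> w; apply: (@continuousB _ _ _ id (fun=> x)); [|exact: cst_continuous].
  apply: (@lsc_addr _ _ phi (fun w => gamma^-1 / 2 * dot (w - x) (w - x))) => // w.
  apply: (@continuousM _ _ (fun=> gamma^-1 / 2) (fun w => dot (w - x) (w - x))).
    exact: cst_continuous.
  exact: dot_continuous.
apply: (lsc_coercive_min (M := `|x| + n0) (w0 := w0)) lobj _.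
move=> w wn; rewrite objw0 prox_objectiveE -enorm_sqr.
have n_ge : n0 <= enorm (w - x).
  apply: le_trans (norm_le_enorm _); rewrite -(lerD2l `|x|).
  apply: le_trans (ltW wn) _; rewrite -{1}(subrK x w) addrC; exact: ler_normD.
apply: le_trans (leeD2r _ (phi_ge w)); rewrite -EFinD lee_fin.
move: n_ge; set n := enorm _ => n_ge.
have n1 : 1 <= n.
  by apply: le_trans n_ge; rewrite lerDl divr_ge0 ?addr_ge0 // ltW.
have cn : `|B| + `|C| + `|r| <= c * n.
  apply: (@le_trans _ _ (c * ((`|B| + `|C| + `|r|) / c))).
    by rewrite mulrCA divff ?mulr1 // gt_eqF.
  rewrite ler_wpM2l ?(ltW c0) //; apply: le_trans n_ge; rewrite lerDr ler01 //.
have h1 : (`|B| + `|C| + `|r|) * n <= c * n ^+ 2.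
  by rewrite expr2 mulrA ler_wpM2r // (le_trans ler01).
have h2 : `|C| + `|r| <= (`|C| + `|r|) * n.
  by rewrite ler_peMr // addr_ge0.
have h3 : B * n <= `|B| * n by rewrite ler_wpM2r ?ler_norm // (le_trans ler01).
have h4 := ler_norm C; have h5 := ler_norm r.
move: h1 h2; rewrite /c !mulrDl; lra.
Qed.

Lemma le0_of_small_steps (a k : R) : 0 <= k ->
  (forall t, 0 < t <= 1 -> a <= t * k) -> a <= 0.
Proof.
move=> k0 H; rewrite leNgt; apply/negP => a0.
have ak : 0 < a + k by rewrite ltr_wpDr.
have /H : 0 < a / (a + k) <= 1.
  by rewrite divr_gt0 //= ler_pdivrMr // mul1r lerDl.
rewrite mulrAC ler_pdivlMr // mulrDr gerDr; apply/negP.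
by rewrite -ltNge mulr_gt0.
Qed.

(** Test the infimum that defines the envelope at [y] with the proximal point
[u] of [x]. *)
Lemma moreau_upper_expansion gamma phi x y u (a b r : R) : 0 < gamma ->
  prox_set gamma phi x u -> phi u = r%:E ->
  moreau gamma phi x = a%:E -> moreau gamma phi y = b%:E ->
  b <= a + gamma^-1 * dot (x - u) (y - x) + gamma^-1 / 2 * dot (y - x) (y - x).
Proof.
move=> gamma0 /moreau_prox_set -> phiu + My; have := moreau_le gamma phi y u.
rewrite My !prox_objectiveE phiu -!EFinD lee_fin => bE [<-].
apply: le_trans bE _; rewrite le_eqVlt; apply/orP; left; apply/eqP.
rewrite !dotE (dotC y u) (dotC x u) (dotC y x); field; exact: lt0r_neq0.
Qed.

(** The lower bound is the hypothesis with [x] and [x + d] exchanged, up to the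
change of [P], which the Lipschitz bound controls. *)
Lemma quadratic_remainder gamma (K : R) (M : 'rV[R]_p -> R)
    (P : 'rV[R]_p -> 'rV[R]_p) x d :
  0 < gamma -> 0 <= K ->
  (forall x y, M y <= M x + gamma^-1 * dot (x - P x) (y - x)
                 + gamma^-1 / 2 * dot (y - x) (y - x)) ->
  (forall x y, dot (P x - P y) (P x - P y) <= K ^+ 2 * dot (x - y) (x - y)) ->
  `|M (x + d) - M x - dot (gamma^-1 *: (x - P x)) d|
    <= gamma^-1 * (1 + K) * dot d d.
Proof.
move=> gamma0 K0 MU PL.
have up := MU x (x + d); have low := MU (x + d) x.
have Pd : `|dot (P (x + d) - P x) d| <= K * dot d d.
  by apply: dot_le_of_norm => //; have := PL (x + d) x; rewrite [x + d]addrC addrK.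
have i0 : 0 < gamma^-1 by rewrite invr_gt0.
have := ler_wpM2l (ltW i0) (ler_norm (dot (P (x + d) - P x) d)).
have := ler_wpM2l (ltW i0) Pd.
have iD : 0 <= gamma^-1 * dot d d by rewrite mulr_ge0 ?dot_ge0 // ltW.
have iKD : 0 <= gamma^-1 * (K * dot d d) by rewrite !mulr_ge0 ?dot_ge0 // ltW.
have xdx : x + d - x = d by rewrite addrC addKr.
have xxd : x - (x + d) = - d by rewrite opprD addrA subrr add0r.
move: up low; rewrite xdx xxd ler_norml !dotE => up low h1 h2.
by apply/andP; split; lra.
Qed.

End ProximalPoints.

(** * The proximal map of a convex function *)

Section ConvexProx.
Context {R : realType} {p : nat}.
Implicit Types (g : 'rV[R]_p -> \bar R) (x y u w : 'rV[R]_p) (gamma : R).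

Lemma econvex_EFin g x y (t a b : R) : econvex g -> 0 <= t <= 1 ->
  g x = a%:E -> g y = b%:E ->
  (g (t *: x + (1 - t) *: y)%R <= (t * a + (1 - t) * b)%:E)%E.
Proof.
by move=> gcvx t01 gx gy; apply: le_trans (gcvx x y t t01) _; rewrite gx gy.
Qed.

(** A finite minimum [m] on the unit ball around a point [x0] of the domain
propagates outwards: the segment from [x0] to a far point [w] meets the ball, so by
convexity [g w] decreases at most linearly with the distance to [x0]. *)
Lemma econvex_linear_minorant g :
  proper_efun g -> econvex g -> lower_semicontinuous g ->
  exists C x0, [/\ 0 <= C, (g x0 < +oo)%E &
    forall w, ((- (C * (1 + `|w - x0|)))%:E <= g w)%E].
Proof.
move=> [gNy [x0 gx0]] gcvx lg.
have gx0_fin : g x0 \is a fin_num by rewrite fin_numE gNy lt_eqF.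
pose K := [set w | `|w - x0| <= 1].
have cK : compact K.
  apply: bounded_closed_compact.
    exists (1 + `|x0|); split=> [|s s1 w /= w1]; first exact: num_real.
    apply: le_trans (ltW s1); rewrite -{1}(subrK x0 w).
    by apply: le_trans (ler_normD _ _) _; rewrite lerD2r.
  apply: (@closed_comp _ _ (fun w : 'rV[R]_p => `|w - x0| : R) [set s | s <= 1]).
    move=> w _; apply: (@continuous_comp _ _ _
      (fun w : 'rV[R]_p => w - x0) (fun w : 'rV[R]_p => `|w|)).
      by apply: (@continuousB _ _ _ id (fun=> x0)); [|exact: cst_continuous].
    exact: norm_continuous.
  exact: closed_le.
have Kx0 : K x0 by rewrite /K /= subrr normr0.
have [z Kz zmin] := lsc_compact_min lg cK (ex_intro _ _ Kx0).
have gz_fin : g z \is a fin_num.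
  by rewrite fin_numE gNy lt_eqF // (le_lt_trans (zmin _ Kx0)).
pose m := fine (g z); pose a := fine (g x0).
have m_le w : K w -> (m%:E <= g w)%E by move=> /zmin; rewrite /m fineK.
exists (`|m| + `|a|), x0; split=> [||w]; rewrite ?addr_ge0 //.
have na := ler_norm a; have nm : - `|m| <= m by rewrite lerNl ler_normr lexx orbT.
have [w1|w1] := leP `|w - x0| 1.
  apply: le_trans (m_le _ w1); rewrite lee_fin.
  apply: (@le_trans _ _ (- (`|m| + `|a|))); last first.
    by have := normr_ge0 a; lra.
  by rewrite lerN2 ler_peMr ?addr_ge0 // lerDl.
case gw : (g w) => [b| |]; last 2 first.
- by rewrite leey.
- by have := gNy w; rewrite gw.
set r := `|w - x0| in w1 *; have r0 : 0 < r by apply: lt_trans w1.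
have t01 : 0 <= r^-1 <= 1 by rewrite invr_ge0 ltW //= invf_le1 // ltW.
have Kzw : K (r^-1 *: w + (1 - r^-1) *: x0).
  rewrite /K /= scalerBl scale1r addrCA addrAC subrr add0r -scalerBr.
  by rewrite normrZ ger0_norm ?invr_ge0 ?normr_ge0 // mulVf // gt_eqF.
have := le_trans (m_le _ Kzw) (econvex_EFin gcvx t01 gw (esym (fineK gx0_fin))).
rewrite -/a !lee_fin => mab.
have : r * m <= b + (r - 1) * a.
  have := ler_wpM2l (ltW r0) mab.
  by rewrite mulrDr !mulrA mulfV ?gt_eqF // mul1r mulrBr mulr1 mulfV ?gt_eqF.
have : (r - 1) * a <= (r - 1) * `|a| by rewrite ler_wpM2l // subr_ge0 ltW.
have : r * - `|m| <= r * m by rewrite ler_wpM2l // ltW.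
have := normr_ge0 a; have := normr_ge0 m.
rewrite mulrDl !mulrDr mulrBl; lra.
Qed.

Lemma convex_prox_nonempty gamma g x :
  0 < gamma -> proper_efun g -> econvex g -> lower_semicontinuous g ->
  prox_set gamma g x !=set0.
Proof.
move=> gamma0 gp gcvx lg.
have [C [x0 [C0 gx0 gC]]] := econvex_linear_minorant gp gcvx lg.
apply: (@prox_set_nonempty _ _ gamma g x x0 0 C (C * (1 + `|x - x0|))) => //.
  by rewrite mulr0.
move=> w; apply: le_trans (gC w); rewrite lee_fin lerN2 !mul0r addr0 -mulrDr.
rewrite ler_wpM2l // -addrA lerD2l addrC -{1}(subrK x w) -addrA.
by apply: le_trans (ler_normD _ _) _; rewrite lerD2r norm_le_enorm.
Qed.

Lemma prox_objective_fin gamma g x u : (exists w, (g w < +oo)%E) ->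
  (g u != -oo)%E -> prox_set gamma g x u -> g u \is a fin_num.
Proof.
move=> [w gw] guNy umin; rewrite fin_numE guNy /=.
have := umin w; rewrite !prox_objectiveE; case: (g u) => //.
by rewrite addye // leye_eq; case: (g w) gw.
Qed.

(** Compare [u] with the points [u + t (w - u)], divide by [t] and let [t] tend to 0:
[(x - u) / gamma] is a subgradient of [g] at [u]. *)
Lemma prox_variational gamma g x u w (r s : R) : 0 < gamma -> econvex g ->
  prox_set gamma g x u -> g u = r%:E -> g w = s%:E ->
  gamma^-1 * dot (x - u) (w - u) <= s - r.
Proof.
move=> gamma0 gcvx umin gu gw; rewrite -subr_le0.
have i0 : 0 < gamma^-1 by rewrite invr_gt0.
apply: (@le0_of_small_steps _ _ (gamma^-1 / 2 * dot (w - u) (w - u))).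
  by rewrite mulr_ge0 ?dot_ge0 // divr_ge0 // ltW.
move=> t /andP[t0 t1].
have t01 : 0 <= t <= 1 by rewrite t1 ltW.
have gz := econvex_EFin gcvx t01 gw gu.
have := umin (t *: w + (1 - t) *: u); rewrite !prox_objectiveE gu => /le_trans.
move=> /(_ _ (leeD2r _ gz)); rewrite -!EFinD lee_fin => h.
rewrite -(ler_pM2l t0); move: h.
have -> : t *: w + (1 - t) *: u - x = t *: (w - u) - (x - u).
  by rewrite scalerBl scale1r scalerBr opprB; apply/rowP => i; rewrite !mxE; ring.
have -> : u - x = - (x - u) by rewrite opprB.
by rewrite !dotE (dotC w x) (dotC w u) (dotC u x); lra.
Qed.

(** Add the variational inequalities at [u] and at [v], each tested at the other. *)
Lemma prox_firmly_nonexpansive gamma g x y u v : 0 < gamma -> econvex g ->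
  prox_set gamma g x u -> prox_set gamma g y v ->
  g u \is a fin_num -> g v \is a fin_num ->
  dot (u - v) (u - v) <= dot (u - v) (x - y).
Proof.
move=> gamma0 gcvx ux vy gu gv.
have := prox_variational gamma0 gcvx ux (esym (fineK gu)) (esym (fineK gv)).
have := prox_variational gamma0 gcvx vy (esym (fineK gv)) (esym (fineK gu)).
move=> h1 h2; have := lerD h1 h2.
rewrite subrKA subrr -mulrDr pmulr_rle0 ?invr_gt0 //.
by rewrite !dotE (dotC y u) (dotC y v) (dotC x u) (dotC x v) (dotC v u); lra.
Qed.

End ConvexProx.

Section ConvexEnvelope.
Context {R : realType} {p : nat}.
Variables (g : 'rV[R]_p -> \bar R) (gamma : R).
Hypotheses (gamma_gt0 : 0 < gamma) (g_proper : proper_efun g).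
Hypotheses (g_convex : econvex g) (g_lsc : lower_semicontinuous g).
Implicit Types x y : 'rV[R]_p.

Local Notation Q := (prox gamma g).
Local Notation M x := (fine (moreau gamma g x)).

Lemma prox_convex x : prox_set gamma g x (Q x).
Proof. by apply: prox_set_prox; exact: convex_prox_nonempty. Qed.

Lemma prox_convex_fin x : g (Q x) = (fine (g (Q x)))%:E.
Proof.
have [gNy gy] := g_proper.
by rewrite fineK // (prox_objective_fin gy (gNy _) (prox_convex x)).
Qed.

Lemma moreau_convexE x : moreau gamma g x =
  (fine (g (Q x)) + gamma^-1 / 2 * dot (Q x - x) (Q x - x))%:E.
Proof.
by rewrite (moreau_prox_set (prox_convex x)) prox_objectiveE prox_convex_fin.
Qed.

Lemma moreau_convex_fin x : moreau gamma g x = (M x)%:E.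
Proof. by rewrite moreau_convexE. Qed.

Lemma prox_convex_firm x y :
  dot (Q x - Q y) (Q x - Q y) <= dot (Q x - Q y) (x - y).
Proof.
apply: (prox_firmly_nonexpansive gamma_gt0 g_convex (prox_convex x) (prox_convex y));
  by rewrite prox_convex_fin.
Qed.

Lemma moreau_convex_expansion x d :
  `|M (x + d) - M x - dot (gamma^-1 *: (x - Q x)) d|
    <= gamma^-1 * (1 + 1) * dot d d.
Proof.
apply: (quadratic_remainder (M := fun z => M z)) => // [y z|y z].
  exact: (moreau_upper_expansion gamma_gt0 (prox_convex y) (prox_convex_fin y)
    (moreau_convex_fin y) (moreau_convex_fin z)).
by apply: cocoercive_lipschitz => //; rewrite mul1r prox_convex_firm.
Qed.

(** Test the infimum at the barycenter of the proximal points of [x] and [y]: both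
terms of the objective are convex. *)
Lemma moreau_convex x y (t : R) : 0 <= t <= 1 ->
  M (t *: x + (1 - t) *: y) <= t * M x + (1 - t) * M y.
Proof.
move=> t01; have /andP[t0 t1] := t01.
have h := econvex_EFin g_convex t01 (prox_convex_fin x) (prox_convex_fin y).
rewrite -lee_fin -moreau_convex_fin.
apply: le_trans (moreau_le _ _ _ (t *: Q x + (1 - t) *: Q y)) _.
rewrite prox_objectiveE; apply: le_trans (leeD2r _ h) _; rewrite -EFinD lee_fin.
have -> : t *: Q x + (1 - t) *: Q y - (t *: x + (1 - t) *: y) =
    t *: (Q x - x) + (1 - t) *: (Q y - y).
  by move: (Q x) (Q y) => u v; apply/rowP => i; rewrite !mxE; ring.
rewrite !moreau_convexE /=; set q := fine _; set r := fine _.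
have i0 : 0 <= gamma^-1 / 2 by rewrite divr_ge0 // invr_ge0 ltW.
have : 0 <= gamma^-1 / 2 *
    (t * (1 - t) * dot ((Q x - x) - (Q y - y)) ((Q x - x) - (Q y - y))).
  by rewrite mulr_ge0 // mulr_ge0 ?dot_ge0 // mulr_ge0 // subr_ge0.
by move: (Q x - x) (Q y - y) => d e; rewrite !dotE (dotC e d); lra.
Qed.

End ConvexEnvelope.

(** * The proximal map of the opposite of a smooth function *)

Section ForwardStep.
Context {R : realType} {p : nat}.
Implicit Types (f : 'rV[R]_p -> R) (x y u v w : 'rV[R]_p) (gamma L : R).

Lemma prox_objective_eopp gamma f x w :
  prox_objective gamma (eopp f) x w =
    (- f w + gamma^-1 / 2 * dot (w - x) (w - x))%:E.
Proof. by rewrite prox_objectiveE. Qed.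

(** Strong growth of the objective of [- f] at a solution of its critical point
equation: the linear terms cancel and [descent] bounds the curvature of [f]. *)
Lemma forward_step_prox gamma L f x u w : 0 < gamma -> 0 <= L -> L_smooth L f ->
  u - gamma *: grad f u = x ->
  - f u + gamma^-1 / 2 * dot (u - x) (u - x) +
    (gamma^-1 - L) / 2 * dot (w - u) (w - u) <=
  - f w + gamma^-1 / 2 * dot (w - x) (w - x).
Proof.
move=> gamma0 L0 fL <-; have := descent u (w - u) L0 fL.
rewrite subrKC ler_norml => /andP[_].
have -> : u - (u - gamma *: grad f u) = gamma *: grad f u.
  by rewrite opprB addrC subrK.
have -> : w - (u - gamma *: grad f u) = (w - u) + gamma *: grad f u
  by rewrite opprB addrA addrAC.
move: (w - u) (grad f u) => d c h.
have -> : gamma^-1 / 2 * dot (d + gamma *: c) (d + gamma *: c) =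
    gamma^-1 / 2 * dot d d + dot c d + gamma^-1 / 2 * dot (gamma *: c) (gamma *: c).
  by rewrite !dotE (dotC d); field; exact: lt0r_neq0.
lra.
Qed.

Lemma prox_eopp_nonempty gamma L f x : 0 < gamma -> 0 <= L -> gamma * L < 1 ->
  L_smooth L f -> prox_set gamma (eopp f) x !=set0.
Proof.
move=> gamma0 L0 gammaL fL.
apply: (@prox_set_nonempty _ _ gamma _ x x L (enorm (grad f x)) (f x)) => //.
- move=> y a; rewrite lte_fin => afy.
  exists [set z | a < - f z] => [|z]; last by rewrite /= lte_fin.
  have fc : {for y, continuous (fun z => - f z)}.
    apply: (@continuousN _ _ _ f); apply: differentiable_continuous.
    by case: fL.
  apply: (fc [set s | a < s]); apply: open_nbhs_nbhs; split => //.
- by rewrite ltry.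
- move=> w; rewrite lee_fin lerN2; have := descent x (w - x) L0 fL.
  rewrite subrKC ler_norml enorm_sqr => /andP[_].
  have : dot (grad f x) (w - x) <= enorm (grad f x) * enorm (w - x).
    apply: le_trans (ler_norm _) _.
    rewrite -ler_sqr ?nnegrE ?mulr_ge0 ?sqrtr_ge0 //.
    by rewrite real_normK ?num_real // exprMn !enorm_sqr cauchy_schwarz.
  lra.
Qed.

(** The residual [r] is [gamma] times the gradient of the objective at [u]; a step
[- t r] would decrease the objective for small [t] unless [r = 0]. *)
Lemma prox_eopp_fermat gamma L f x u : 0 < gamma -> 0 <= L -> L_smooth L f ->
  prox_set gamma (eopp f) x u -> u - gamma *: grad f u = x.
Proof.
move=> gamma0 L0 fL umin.
pose r := u - gamma *: grad f u - x.
suff /dot_eq0/eqP : dot r r = 0 by rewrite subr_eq0 => /eqP.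
have i0 : 0 < gamma^-1 by rewrite invr_gt0.
apply/eqP; rewrite eq_le dot_ge0 andbT.
apply: (@le0_of_small_steps _ _ ((1 + gamma * L) / 2 * dot r r)).
  by rewrite mulr_ge0 ?dot_ge0 // divr_ge0 // addr_ge0 // mulr_ge0 // ltW.
move=> t /andP[t0 _].
have := umin (u - t *: r); rewrite !prox_objective_eopp lee_fin.
have := descent u (- t *: r) L0 fL; rewrite ler_norml => /andP[+ _].
have gE : grad f u = gamma^-1 *: (u - x - r).
  have -> : u - x - r = gamma *: grad f u.
    by rewrite /r; apply/rowP => i; rewrite !mxE; ring.
  by rewrite scalerA mulVf ?scale1r // lt0r_neq0.
have -> : u - t *: r - x = (u - x) - t *: r by rewrite addrAC.
rewrite scaleNr gE; clearbody r; move: (u - x) => z.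
rewrite !dotE (dotC r z) => h1 h2.
rewrite -(ler_pM2l t0) -(ler_pM2l i0).
have -> : gamma^-1 * (t * (t * ((1 + gamma * L) / 2 * dot r r))) =
  t ^+ 2 * ((gamma^-1 + L) / 2 * dot r r) by field; rewrite lt0r_neq0.
lra.
Qed.

End ForwardStep.

Section ConcaveEnvelope.
Context {R : realType} {p : nat}.
Variables (f : 'rV[R]_p -> R) (L gamma : R).
Hypotheses (L_ge0 : 0 <= L) (f_smooth : L_smooth L f).
Hypotheses (gamma_gt0 : 0 < gamma) (gammaL : gamma * L < 1).
Implicit Types x y u w : 'rV[R]_p.

Local Notation P := (prox gamma (eopp f)).
Local Notation M x := (fine (moreau gamma (eopp f) x)).
Local Notation a := ((1 - gamma * L)^-1).

Let curvature_gt0 : 0 < (gamma^-1 - L) / 2.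
Proof. by rewrite divr_gt0 // subr_gt0 -div1r ltr_pdivlMr // mulrC. Qed.

Lemma forward_step_prox_set x u : u - gamma *: grad f u = x ->
  prox_set gamma (eopp f) x = [set u].
Proof.
move=> ux; have growth w := forward_step_prox w gamma_gt0 L_ge0 f_smooth ux.
apply/seteqP; split=> [w /(_ u)|_ -> w]; rewrite !prox_objective_eopp lee_fin.
  move=> wu; apply/eqP; rewrite -subr_eq0; apply/eqP.
  apply: dot_eq0; apply/eqP; rewrite eq_le dot_ge0 andbT.
  by have := growth w; rewrite -(pmulr_rle0 _ curvature_gt0); lra.
by apply: le_trans (growth w); rewrite lerDl mulr_ge0 ?dot_ge0 // ltW.
Qed.

Lemma moreau_eopp x u : u - gamma *: grad f u = x ->
  moreau gamma (eopp f) x = (- f u + gamma^-1 / 2 * dot (u - x) (u - x))%:E.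
Proof.
move=> ux; rewrite -prox_objective_eopp; apply: moreau_prox_set.
by rewrite (forward_step_prox_set ux).
Qed.

Lemma prox_eoppK x : P x - gamma *: grad f (P x) = x.
Proof.
apply: (prox_eopp_fermat gamma_gt0 L_ge0 f_smooth); apply: prox_set_prox.
exact: (prox_eopp_nonempty _ gamma_gt0 L_ge0 gammaL f_smooth).
Qed.

Lemma prox_set_eopp x : prox_set gamma (eopp f) x = [set P x].
Proof. exact: forward_step_prox_set (prox_eoppK x). Qed.

Lemma moreau_eoppE x : moreau gamma (eopp f) x =
  (- f (P x) + gamma^-1 / 2 * dot (P x - x) (P x - x))%:E.
Proof. exact: moreau_eopp (prox_eoppK x). Qed.

Lemma moreau_eopp_fin x : moreau gamma (eopp f) x = (M x)%:E.
Proof. by rewrite moreau_eoppE. Qed.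

Lemma inv_one_sub_ge1 : 1 <= a.
Proof. by rewrite invf_ge1 ?subr_gt0 // gerBl mulr_ge0 // ltW. Qed.

(** The inverse of [P] is [id - gamma * grad f], which is strongly monotone with
constant [1 - gamma * L]. *)
Lemma prox_eopp_cocoercive x y :
  dot (P x - P y) (P x - P y) <= a * dot (P x - P y) (x - y).
Proof.
have gL0 : 0 < 1 - gamma * L by rewrite subr_gt0.
rewrite mulrC ler_pdivlMr // mulrC.
have -> : x - y = (P x - P y) - gamma *: (grad f (P x) - grad f (P y)).
  move: (prox_eoppK x) (prox_eoppK y); move: (P x) (P y) => u v <- <-.
  by move: (grad f u) (grad f v) => c e; apply/rowP => i; rewrite !mxE; ring.
have := f_smooth.2 (P x) (P y); rewrite enorm_leP // => /(dot_le_of_norm L_ge0).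
move=> /(le_trans (ler_norm _)) /(ler_wpM2l (ltW gamma_gt0)).
move: (P x - P y) (grad f (P x) - grad f (P y)) => d e.
by rewrite !dotE (dotC d e); lra.
Qed.

Lemma moreau_eopp_expansion x d :
  `|M (x + d) - M x - dot (gamma^-1 *: (x - P x)) d|
    <= gamma^-1 * (1 + a) * dot d d.
Proof.
have a_ge1 := inv_one_sub_ge1.
apply: (quadratic_remainder (M := fun z => M z)) => // [|y z|y z].
- exact: le_trans ler01 a_ge1.
- apply: (moreau_upper_expansion gamma_gt0 _ _
    (moreau_eopp_fin y) (moreau_eopp_fin z)); last by [].
  by rewrite prox_set_eopp.
- by apply: (cocoercive_lipschitz a_ge1); exact: prox_eopp_cocoercive.
Qed.

(** Substituting [w = z + d], the envelope at [z] is the infimum over [d] of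
[- f (z + d) + |d|^2 / (2 gamma)], which is concave in [z] for each fixed [d]; the
[d] that is optimal at the barycenter serves as a competitor at [x] and [y]. *)
Lemma moreau_eopp_concave x y (t : R) :
  (forall x y (t : R), 0 <= t <= 1 ->
    f (t *: x + (1 - t) *: y) <= t * f x + (1 - t) * f y) ->
  0 <= t <= 1 ->
  t * M x + (1 - t) * M y <= M (t *: x + (1 - t) *: y).
Proof.
move=> f_convex t01; have /andP[t0 t1] := t01.
set z := (t *: x + _); pose d := P z - z.
have M_le w : M w <= - f (w + d) + gamma^-1 / 2 * dot d d.
  rewrite -lee_fin -moreau_eopp_fin; apply: le_trans (moreau_le _ _ _ (w + d)) _.
  by rewrite prox_objective_eopp [w + d - w]addrC addKr.
have -> : M z = - f (z + d) + gamma^-1 / 2 * dot d d.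
  by rewrite moreau_eoppE /= subrKC.
have zd : z + d = t *: (x + d) + (1 - t) *: (y + d).
  by rewrite /z; clearbody d; apply/rowP => i; rewrite !mxE; ring.
have h := f_convex (x + d) (y + d) _ t01; rewrite -zd in h.
have h1 := ler_wpM2l t0 (M_le x).
have h2 : (1 - t) * M y <= (1 - t) * (- f (y + d) + gamma^-1 / 2 * dot d d).
  by rewrite ler_wpM2l // subr_ge0.
by move: h1 h2; lra.
Qed.

End ConcaveEnvelope.

(** * The DC envelope *)

Section DCEnvelope.
Context {R : realType} {p : nat}.
Variables (f : 'rV[R]_p -> R) (L gamma : R) (g : 'rV[R]_p -> \bar R).
Hypotheses (L_ge0 : 0 <= L) (f_smooth : L_smooth L f).
Hypotheses (gamma_gt0 : 0 < gamma) (gammaL : gamma * L < 1).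
Implicit Types x y u : 'rV[R]_p.

Local Notation P := (prox gamma (eopp f)).
Local Notation Q := (prox gamma g).
Local Notation E := (dc_envelope gamma g (eopp f)).

(** At [x = u - gamma * grad f u] one has [u - x = gamma * grad f u], so the envelope
of [- f] at [x] is minus the smooth part of the forward-backward envelope at [u]. *)
Lemma fb_envelopeE u : fb_envelope gamma f g u = E (u - gamma *: grad f u).
Proof.
rewrite /fb_envelope /dc_envelope.
rewrite (@moreau_eopp _ _ _ _ _ L_ge0 f_smooth gamma_gt0 gammaL _ u) //.
rewrite addeC; congr (_ + _)%E.
rewrite -EFinN enorm_sqr opprB subrKC !dotE; congr EFin.
by field; exact: lt0r_neq0.
Qed.

Hypotheses (g_proper : proper_efun g) (g_convex : econvex g).
Hypothesis g_lsc : lower_semicontinuous g.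

Lemma dc_envelopeE x :
  E x = (fine (moreau gamma g x) - fine (moreau gamma (eopp f) x))%:E.
Proof.
by rewrite /dc_envelope moreau_convex_fin // (moreau_eopp_fin L_ge0 f_smooth).
Qed.

Lemma dc_envelope_grad x : differentiable (fine \o E) x /\
  grad (fine \o E) x = gamma^-1 *: (P x - Q x).
Proof.
pose C := gamma^-1 * (1 + 1) + gamma^-1 * (1 + (1 - gamma * L)^-1).
apply: (@grad_quadratic_bound _ _ _ _ _ C) => d; rewrite /= !dc_envelopeE /=.
have hg := moreau_convex_expansion gamma_gt0 g_proper g_convex g_lsc x d.
have hf := moreau_eopp_expansion L_ge0 f_smooth gamma_gt0 gammaL x d.
rewrite mulrDl; apply: le_trans (lerD hg hf); apply: le_trans (ler_normB _ _).
rewrite le_eqVlt; apply/orP; left; apply/eqP; congr `|_|.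
by rewrite !dotE; ring.
Qed.

Lemma dc_envelope_smooth : L_smooth (1 / (gamma * (1 - gamma * L))) (fine \o E).
Proof.
have a_ge1 := inv_one_sub_ge1 L_ge0 gamma_gt0 gammaL.
split=> [x|x y]; first by case: (dc_envelope_grad x).
rewrite !(proj2 (dc_envelope_grad _)) div1r invfM enorm_leP; last first.
  by rewrite mulr_ge0 ?invr_ge0 ?(ltW gamma_gt0) // subr_ge0 ltW.
rewrite -scalerBr dotZl dotZr mulrA -expr2 exprMn -[leRHS]mulrA.
rewrite ler_wpM2l ?sqr_ge0 //.
have -> : P x - Q x - (P y - Q y) = (P x - P y) - (Q x - Q y).
  by rewrite !opprD !opprK addrACA.
apply: cocoercive_sub a_ge1 _ _; first exact: prox_eopp_cocoercive.
exact: prox_convex_firm.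
Qed.

Lemma dc_envelope_convex x y (t : R) :
  (forall x y (t : R), 0 <= t <= 1 ->
    f (t *: x + (1 - t) *: y) <= t * f x + (1 - t) * f y) ->
  0 <= t <= 1 ->
  fine (E (t *: x + (1 - t) *: y)) <= t * fine (E x) + (1 - t) * fine (E y).
Proof.
move=> f_convex t01; rewrite !dc_envelopeE /=.
have := moreau_convex gamma_gt0 g_proper g_convex g_lsc x y t01.
have := moreau_eopp_concave L_ge0 f_smooth gamma_gt0 gammaL x y f_convex t01.
by lra.
Qed.

End DCEnvelope.

Theorem mainTheorem2 (R : realType) (p : nat)
    (f : 'rV[R]_p -> R) (Lf : R) (g : 'rV[R]_p -> \bar R)
    (Lf_ge0 : 0 <= Lf) (f_smooth : L_smooth Lf f)
    (g_proper : proper_efun g) (g_convex : econvex g)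
    (g_lsc : lower_semicontinuous g)
    (gamma : R) (gamma_gt0 : 0 < gamma)
    (gamma_lt : (gamma%:E < (Lf%:E)^-1)%E) :
  let E := dc_envelope gamma g (eopp f) in
  let phiFB := fb_envelope gamma f g in
  [/\ phiFB = E \o (fun u => u - gamma *: grad f u),
      (forall x, prox_set gamma (eopp f) x = [set prox gamma (eopp f) x])
        /\ E = phiFB \o prox gamma (eopp f),
      (forall x, E x \is a fin_num)
        /\ L_smooth (1 / (gamma * (1 - gamma * Lf))) (fine \o E)
    & convex_function [set: convex_lmodType 'rV[R]_p] f ->
      convex_function [set: convex_lmodType 'rV[R]_p] (fine \o E)].
Proof.
have gammaL : gamma * Lf < 1.
  move: gamma_lt; rewrite inver; case: eqP => [-> _|/eqP L0].
    by rewrite mulr0.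
  by rewrite lte_fin -div1r ltr_pdivlMr // lt_def L0.
move=> E phiFB; split.
- apply/funext => u.
  exact: (fb_envelopeE g Lf_ge0 f_smooth gamma_gt0 gammaL u).
- split=> [x|]; first exact: (prox_set_eopp Lf_ge0 f_smooth gamma_gt0 gammaL).
  apply/funext => x; rewrite /phiFB /=.
  rewrite (fb_envelopeE g Lf_ge0 f_smooth gamma_gt0 gammaL).
  by rewrite (prox_eoppK Lf_ge0 f_smooth gamma_gt0 gammaL).
- split=> [x|]; last exact: dc_envelope_smooth.
  by rewrite /E (dc_envelopeE Lf_ge0 f_smooth).
- move=> f_cvx t x y _ _.
  have f_convex u v s : 0 <= s <= 1 ->
      f (s *: u + (1 - s) *: v) <= s * f u + (1 - s) * f v.
    move=> /andP[s0 s1].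
    exact: (f_cvx (Itv01 s0 s1) u v (in_setT _) (in_setT _)).
  apply: (dc_envelope_convex Lf_ge0 f_smooth gamma_gt0 gammaL) => //.
  by rewrite ge0 le1.
Qed.
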